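(* In the stochastic dynamic programming setting described in the context (under its standing assumptions (H1) and (H2)), let $X$ be a separable Asplund space, and let the constraint multifunction be given by $$\Gamma(x,\omega)=\{y\in X\mid\varphi_i(x,y,\omega)\le0,\ i=1,\dots,m;\ \varphi_i(x,y,\omega)=0,\ i=m+1,\dots,m+r\},$$ where $\varphi_i\colon X\times X\times\Omega\to\mathbb R$ with $\varphi_i(x,y,\cdot)$ measurable. Assume that, for every $\omega\in\Omega$, $u(\cdot,\cdot,\omega)$ and $\varphi_i(\cdot,\cdot,\omega)$, $i=1,\dots,m+r$, are strictly differentiable at $(\bar x,\bar y)\in\mathrm{gph}\,G(\cdot,\omega)$, that the policy multifunction $G(\cdot,\omega)$ is inner semicontinuous at $(\bar x,\bar y)$, and that the parametric Mangasarian–Fromovitz constraint qualification is satisfied at $(\bar x,\bar y)$. Then $$\partial v(\bar x,\omega)\subset\bigcup_{\lambda\in\Lambda(\bar x,\bar y,\omega)}\Big\{\nabla_xu(\bar x,\bar y,\omega)+\sum_{i=1}^{m+r}\lambda_i\nabla_x\varphi_i(\bar x,\bar y,\omega)\Big\},\qquad\omega\in\Omega.$$ Furthermore, equality holds therein provided that $G(\cdot,\omega)$ admits a local upper Lipschitzian selector around $(\bar x,\bar y)$.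
   Context: Setting. $X$ is a real Banach space, $(\Omega,\Sigma)$ a measurable space, $P$ a stochastic kernel on it ($P(\cdot\mid\omega)$ is a probability measure on $\Sigma$ for each $\omega$, $P(A\mid\cdot)$ is measurable for each $A\in\Sigma$), $\beta\in[0,1)$, $u\colon X\times X\times\Omega\to\mathbb R$ a cost function, $\Gamma\colon X\times\Omega\rightrightarrows X$ a constraint mapping with nonempty values. Standing assumptions (two parallel versions, norm or weak): (H1) $u$ is bounded, $u(\cdot,\cdot,\omega)$ is continuous (resp. weakly continuous) for every $\omega$, $u(x,y,\cdot)$ is measurable for every $(x,y)$; (H2) $\Gamma$ is measurable (i.e. $\{(x,\omega)\mid\Gamma(x,\omega)\cap U\ne\emptyset\}\in\mathrm{Borel}(X,\|\cdot\|)\otimes\Sigma$ for every norm-open $U\subset X$) with compact (resp. weakly compact) values, $\Gamma(\cdot,\omega)$ is continuous (resp. weakly continuous) for every $\omega$, and $\Gamma(x,\cdot)$ is measurable for every $x$. The value function $v(x,\omega)$ is the infimum of $u(x_0,x_1,\omega_0)+\sum_{t\ge1}\int\beta^tu(x_t,x_{t+1},\omega_t)P^t(d\omega^t\mid\omega_0)$ subject to $x_{t+1}\in\Gamma(x_t,\omega_t)$, $t=0,1,\dots$, $(x_0,\omega_0)=(x,\omega)$, where $P^t(\cdot\mid\omega_0)$ is the probability measure on $\Sigma^t$ obtained by iterating $P$. For separable $X$, $v$ is the unique bounded function on $X\times\Omega$ that is continuous (resp. weakly continuous) in $x$, measurable in $\omega$, and satisfies the Bellman equation $v(x,\omega)=\min_{y\in\Gamma(x,\omega)}\{u(x,y,\omega)+\beta\int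 v(y,\omega')P(d\omega'\mid\omega)\}$; this may be taken as its definition. The policy multifunction is $G(x,\omega):=\{y\in\Gamma(x,\omega)\mid v(x,\omega)=u(x,y,\omega)+\beta\int v(y,\omega')P(d\omega'\mid\omega)\}$, $\mathrm{gph}\,G(\cdot,\omega)=\{(x,y)\mid y\in G(x,\omega)\}$. $G(\cdot,\omega)$ is inner semicontinuous at $(\bar x,\bar y)$ if for every sequence $x_k\to\bar x$ there is a sequence $y_k\in G(x_k,\omega)$ containing a subsequence norm-converging to $\bar y$. $\phi$ is strictly differentiable at $\bar z$ with strict derivative $\nabla\phi(\bar z)$ if $\lim_{z\to\bar z,\,h\to0}\frac{\phi(z+h)-\phi(z)-\langle\nabla\phi(\bar z),h\rangle}{\|h\|}=0$; $\nabla_x,\nabla_y$ are the partial derivatives. Active indices: $I(\bar x,\bar y,\omega)=\{i\in\{1,\dots,m+r\}\mid\varphi_i(\bar x,\bar y,\omega)=0\}$. Parametric MFCQ at $(\bar x,\bar y)$: for every $\omega\in\Omega$, (i) the derivatives $\nabla\varphi_i(\bar x,\bar y,\omega)$, $i=m+1,\dots,m+r$, are linearly independent, and (ii) there is $\xi\in X\times X$ with $\langle\nabla\varphi_i(\bar x,\bar y,\omega),\xi\rangle=0$ for $i=m+1,\dots,m+r$ and $\langle\nabla\varphi_i(\bar x,\bar y,\omega),\xi\rangle<0$ for $i\in\{1,\dots,m\}\cap I(\bar x,\bar y,\omega)$. Lagrange multipliers: with $\varphi(x,y,\omega):=u(x,y,\omega)+\beta\int v(y,\omega')P(d\omega'\mid\omega)$,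 $\Lambda(\bar x,\bar y,\omega)$ is the set of $\lambda\in\mathbb R^{m+r}$ with $\nabla_y\varphi(\bar x,\bar y,\omega)+\sum_{i=1}^{m+r}\lambda_i\nabla_y\varphi_i(\bar x,\bar y,\omega)=0$ and $\lambda_i\ge0$, $\lambda_i\varphi_i(\bar x,\bar y,\omega)=0$ for $i=1,\dots,m$. Here $\nabla_y\varphi(\bar x,\bar y,\omega)=\nabla_yu(\bar x,\bar y,\omega)+\beta\int\nabla v(\bar y,\omega')P(d\omega'\mid\omega)$, the (strict) differentiability of $\varphi(\cdot,\cdot,\omega)$ at $(\bar x,\bar y)$ and of $v(\cdot,\omega')$ at $\bar y$ being presupposed in this definition. A function $f\colon D\subset X\to X$ is locally upper Lipschitzian at $\bar x\in D$ if there are $\eta>0$, $\ell\ge0$ with $\|f(x)-f(\bar x)\|\le\ell\|x-\bar x\|$ for all $x\in D$ with $\|x-\bar x\|\le\eta$; it is a local upper Lipschitzian selector of $F\colon D\rightrightarrows X$ around $(\bar x,\bar y)\in\mathrm{gph}\,F$ if moreover $f(\bar x)=\bar y$ and $f(x)\in F(x)$ for all $x$ in some neighborhood of $\bar x$. A Banach space is Asplund if every continuous convex function on an open convex subset is Fréchet differentiable on a dense subset of it. The limiting subdifferential $\partial\phi(\bar x)$ is the set of $x^*\in X^*$ for which there are $x_k\to\bar x$ and $x_k^*\to x^*$ weak$^*$ with $\liminf_{x\to x_k}\frac{\phi(x)-\phi(x_k)-\langle x_k^*,x-x_k\rangle}{\|x-x_k\|}\ge0$ for every $k$; $\partial v(\bar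 x,\omega)$ is that of $v(\cdot,\omega)$ at $\bar x$. *)

(* Defs.v *)
From HB Require Import structures.
From mathcomp Require Import all_boot all_order all_algebra.
From mathcomp Require Import all_classical all_reals all_analysis.
Set Implicit Arguments.
Unset Strict Implicit.
Unset Printing Implicit Defensive.
Import Order.TTheory GRing.Theory Num.Theory.
Import numFieldNormedType.Exports.
Local Open Scope classical_set_scope.
Local Open Scope ring_scope.

Section banach.
Context {R : realType}.

(* Elements of the dual space are represented by their underlying functions,
   so that sums and scalar multiples of functionals are pointwise. *)
Definition topological_dual (X : normedModType R) : set (X -> R) :=
  [set f | linear (f : X -> R^o) /\ continuous (f : X -> R^o)].

(* The weak topology is the one induced by x |-> (f |-> f x), the functions on
   the dual carrying the topology of pointwise convergence.  [weak_space X] is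
   an alias of [X], so maps on [X] can be read as maps on [weak_space X]. *)
Definition dual_eval (X : normedModType R) (x : X) :
    {ptws set_type (@topological_dual X) -> R^o} :=
  fun f => set_val f x.

Definition weak_space (X : normedModType R) := initial_topology (@dual_eval X).

Definition separable (T : topologicalType) : Prop :=
  exists2 D : set T, countable D & dense D.

Definition asplund (X : normedModType R) : Prop :=
  forall (U : set X) (f : X -> R^o),
    open U -> convex_set U ->
    {within U, continuous f} -> convex_function U f ->
    U `<=` closure [set x | U x /\ differentiable f x].

(* (z, h) tends to (zbar, 0) with h <> 0. *)
Definition is_strict_derivative (Z : normedModType R) (f : Z -> R) (zbar : Z)
    (D : Z -> R) : Prop :=
  topological_dual D /\
  (fun p : Z * Z => (f (p.1 + p.2) - f p.1 - D p.2) / `|p.2| : R^o)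
    @ filter_prod (nbhs zbar) (dnbhs (0 : Z)) --> (0 : R^o).

Definition strictly_differentiable (Z : normedModType R) (f : Z -> R)
    (zbar : Z) : Prop :=
  exists D, is_strict_derivative f zbar D.

Definition strict_gradient (Z : normedModType R) (f : Z -> R) (zbar : Z) :
    Z -> R :=
  get [set D | is_strict_derivative f zbar D].

Definition strict_gradient_x (X : normedModType R) (f : X -> X -> R) (x y : X) :
    X -> R :=
  fun h => strict_gradient (fun z : X * X => f z.1 z.2) (x, y) (h, 0).

Definition strict_gradient_y (X : normedModType R) (f : X -> X -> R) (x y : X) :
    X -> R :=
  fun h => strict_gradient (fun z : X * X => f z.1 z.2) (x, y) (0, h).

Definition frechet_subgradient (X : normedModType R) (f : X -> R) (xbar : X)
    (xs : X -> R) : Prop :=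
  topological_dual xs /\
  (0 <= limf_einf
    (fun x => ((f x - f xbar - xs (x - xbar)) / `|x - xbar|)%:E)
    (dnbhs xbar))%E.

Definition limiting_subdifferential (X : normedModType R) (f : X -> R)
    (xbar : X) : set (X -> R) :=
  [set xs | topological_dual xs /\
    exists (x_ : nat -> X) (xs_ : nat -> X -> R),
      [/\ x_ @ \oo --> xbar,
          forall h : X, (fun k => xs_ k h : R^o) @ \oo --> (xs h : R^o) &
          forall k, frechet_subgradient f (x_ k) (xs_ k)]].

End banach.

Section multifunctions.

Definition multifun_continuous (S T : topologicalType) (F : S -> set T) : Prop :=
  forall x (U : set T), open U ->
    (F x `<=` U -> \forall x' \near x, F x' `<=` U) /\
    (F x `&` U !=set0 -> \forall x' \near x, F x' `&` U !=set0).

Definition inner_semicontinuous (S T : topologicalType) (F : S -> set T)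
    (xbar : S) (ybar : T) : Prop :=
  forall x_ : nat -> S, x_ @ \oo --> xbar ->
    exists2 y_ : nat -> T, (forall k, F (x_ k) (y_ k)) &
      exists2 s : nat -> nat, {homo s : i j / (i < j)%N} &
        y_ \o s @ \oo --> ybar.

Context {R : realType} {X : normedModType R}.

Definition locally_upper_lipschitzian (D : set X) (f : X -> X) (xbar : X) : Prop :=
  exists eta l : R, [/\ 0 < eta, 0 <= l &
    forall x, D x -> `|x - xbar| <= eta ->
      `|f x - f xbar| <= l * `|x - xbar|].

Definition upper_lipschitzian_selector (D : set X) (F : X -> set X)
    (xbar ybar : X) (f : X -> X) : Prop :=
  [/\ D xbar, locally_upper_lipschitzian D f xbar, f xbar = ybar &
      \forall x \near xbar, D x -> F x (f x)].

End multifunctions.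

Section dynamic_programming.
Context {R : realType} {X : completeNormedModType R}.
Context {d : measure_display} {Omega : measurableType d}.
Variable P : R.-pker Omega ~> Omega.
Variable beta : R.

(* [T] is meant to be [X] or [weak_space X]: it is the topology for which
   continuity and compactness are required, whereas the measurability
   conditions always refer to the norm topology of [X]. *)
Record cost_assumptions (T : topologicalType) (u : T -> T -> Omega -> R) :
    Prop := {
  cost_bounded : exists M : R, forall x y w, `|u x y w| <= M;
  cost_continuous : forall w, continuous (fun z : T * T => u z.1 z.2 w : R^o);
  cost_measurable : forall x y, measurable_fun setT (u x y)
}.

Record constraint_measurability (Gamma : X -> Omega -> set X) : Prop := {
  constraint_nonempty : forall x w, Gamma x w !=set0;
  constraint_measurable : forall U : set X, open U ->
    measurable [set z : g_sigma_algebraType (@open X) * Omega |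
                  Gamma z.1 z.2 `&` U !=set0];
  constraint_section_measurable : forall x (U : set X), open U ->
    measurable [set w | Gamma x w `&` U !=set0]
}.

Record constraint_topology (T : topologicalType) (Gamma : T -> Omega -> set T) :
    Prop := {
  constraint_compact : forall x w, compact (Gamma x w);
  constraint_continuous : forall w, multifun_continuous (Gamma^~ w)
}.

Definition bellman_objective (u : X -> X -> Omega -> R) (v : X -> Omega -> R)
    (x y : X) (w : Omega) : R :=
  u x y w + beta * \int[P w]_w' v y w'.

Record value_function (u : X -> X -> Omega -> R)
    (Gamma : X -> Omega -> set X) (v : X -> Omega -> R) : Prop := {
  value_bounded : exists M : R, forall x w, `|v x w| <= M;
  value_measurable : forall x, measurable_fun setT (v x);
  value_bellman : forall x w,
    (exists2 y, Gamma x w y & v x w = bellman_objective u v x y w) /\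
    (forall y, Gamma x w y -> v x w <= bellman_objective u v x y w)
}.

Definition value_continuous (T : topologicalType) (v : T -> Omega -> R) : Prop :=
  forall w, continuous (v^~ w : T -> R^o).

Definition norm_setting (u : X -> X -> Omega -> R)
    (Gamma : X -> Omega -> set X) (v : X -> Omega -> R) : Prop :=
  [/\ @cost_assumptions X u, constraint_measurability Gamma,
      @constraint_topology X Gamma, value_function u Gamma v &
      @value_continuous X v].

Definition weak_setting (u : X -> X -> Omega -> R)
    (Gamma : X -> Omega -> set X) (v : X -> Omega -> R) : Prop :=
  [/\ @cost_assumptions (weak_space X) u, constraint_measurability Gamma,
      @constraint_topology (weak_space X) Gamma, value_function u Gamma v &
      @value_continuous (weak_space X) v].

Definition policy (u : X -> X -> Omega -> R) (Gamma : X -> Omega -> set X)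
    (v : X -> Omega -> R) (x : X) (w : Omega) : set X :=
  [set y | Gamma x w y /\ v x w = bellman_objective u v x y w].

(* Indices are counted from 0: i < m are the inequality constraints and
   m <= i < m + r the equality constraints. *)
Definition constraint_set (m r : nat) (phi : 'I_(m + r) -> X -> X -> Omega -> R)
    (x : X) (w : Omega) : set X :=
  [set y | (forall i : 'I_(m + r), (i < m)%N -> phi i x y w <= 0) /\
           (forall i : 'I_(m + r), (m <= i)%N -> phi i x y w = 0)].

Definition active (m r : nat) (phi : 'I_(m + r) -> X -> X -> Omega -> R)
    (x y : X) (w : Omega) : set 'I_(m + r) :=
  [set i | phi i x y w = 0].

Definition parametric_MFCQ (m r : nat)
    (phi : 'I_(m + r) -> X -> X -> Omega -> R) (x y : X) : Prop :=
  forall w,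
    let grad i := strict_gradient (fun z : X * X => phi i z.1 z.2 w) (x, y) in
    (forall c : 'I_(m + r) -> R,
       (forall h, \sum_(i < m + r | (m <= i)%N) c i * grad i h = 0) ->
       forall i : 'I_(m + r), (m <= i)%N -> c i = 0) /\
    (exists xi : X * X,
       (forall i : 'I_(m + r), (m <= i)%N -> grad i xi = 0) /\
       (forall i : 'I_(m + r), (i < m)%N -> active phi x y w i -> grad i xi < 0)).

(* The y-gradient of the Bellman objective is
   grad_y u + beta * (integral of grad v(y, w') under P w) as soon as one may
   differentiate under the integral sign. *)
Definition multipliers (u : X -> X -> Omega -> R) (v : X -> Omega -> R)
    (m r : nat) (phi : 'I_(m + r) -> X -> X -> Omega -> R)
    (x y : X) (w : Omega) : set 'rV[R]_(m + r) :=
  [set lambda |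
    (forall h,
       strict_gradient_y (fun x y => bellman_objective u v x y w) x y h +
       \sum_(i < m + r)
         lambda 0 i * strict_gradient_y (fun x y => phi i x y w) x y h = 0) /\
    (forall i : 'I_(m + r), (i < m)%N -> 0 <= lambda 0 i /\ lambda 0 i * phi i x y w = 0)].

Definition lagrange_gradient (u : X -> X -> Omega -> R)
    (m r : nat) (phi : 'I_(m + r) -> X -> X -> Omega -> R)
    (x y : X) (w : Omega) (lambda : 'rV[R]_(m + r)) : X -> R :=
  fun h => strict_gradient_x (fun x y => u x y w) x y h +
    \sum_(i < m + r)
      lambda 0 i * strict_gradient_x (fun x y => phi i x y w) x y h.

End dynamic_programming.

(* Main.v *)
(* Let [xs] be a limiting subgradient of [v] at [xbar], the limit of Frechet
   subgradients [xs_k] at [x_k].  Inner semicontinuity provides points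
   [(x_k, y_k)] of the graph of [G] tending (along a subsequence) to
   [(xbar, ybar)]; there the objective minus [xs_k] is minimal to first order on
   the graph of [Gamma].  By strict differentiability the constraints are
   uniformly close to their linearizations at [(xbar, ybar)], so a direction that
   is tangent to the equalities and strictly decreases the active inequalities
   can be followed from [(x_k, y_k)], after a correction found by Banach's fixed
   point theorem in the coordinates of the equality constraints.  In the limit
   [(xs, 0)] minus the gradient of the objective is nonpositive on these
   directions, hence by MFCQ on the whole linearized cone, and Farkas' lemma gives
   the multipliers.  Conversely, an upper Lipschitzian selector turns the
   first-order expansion of the Lagrangian into a Frechet subgradient inequality
   for [v]. *)
Require Import Defs.
From HB Require Import structures.
From mathcomp Require Import all_boot all_order all_algebra.
From mathcomp Require Import all_classical all_reals all_analysis.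
From mathcomp Require Import ring lra.
Set Implicit Arguments.
Unset Strict Implicit.
Unset Printing Implicit Defensive.
Import Order.TTheory GRing.Theory Num.Theory.
Import numFieldNormedType.Exports.
Local Open Scope classical_set_scope.
Local Open Scope ring_scope.

(** * Farkas' lemma for finitely many linear functionals *)

Section farkas.
Context {R : realType} {Z : lmodType R}.

Lemma scalar_linearD (f : Z -> R) : linear (f : Z -> R^o) ->
  forall x y, f (x + y) = f x + f y.
Proof. by move=> lf x y; have := lf 1 x y; rewrite !scale1r. Qed.

Lemma scalar_linear0 (f : Z -> R) : linear (f : Z -> R^o) -> f 0 = 0.
Proof.
move=> /scalar_linearD/(_ 0 0); rewrite addr0 => /esym/eqP.
by rewrite -subr_eq0 addrK => /eqP.
Qed.

Lemma scalar_linearZ (f : Z -> R) : linear (f : Z -> R^o) ->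
  forall a x, f (a *: x) = a * f x.
Proof.
by move=> lf a x; have := lf a x 0; rewrite addr0 (scalar_linear0 lf) addr0.
Qed.

Lemma scalar_linearB (f : Z -> R) : linear (f : Z -> R^o) ->
  forall x y, f (x - y) = f x - f y.
Proof.
move=> lf x y; rewrite scalar_linearD// -scaleN1r scalar_linearZ//.
by rewrite mulN1r.
Qed.

Lemma scalar_linear_sum (f : Z -> R) : linear (f : Z -> R^o) ->
  forall (I : Type) (s : seq I) (Q : pred I) (F : I -> Z),
  f (\sum_(i <- s | Q i) F i) = \sum_(i <- s | Q i) f (F i).
Proof.
move=> lf I s Q F.
exact: (big_morph f (scalar_linearD lf) (scalar_linear0 lf)).
Qed.

(* Induction on the number of functionals: if the first functional [g i] is
   needed, some [h0] violates the conclusion and satisfies the other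
   inequalities, and one projects along [h0] onto the kernel of [g i]. *)
Lemma farkas_seq (I : eqType) (s : seq I) (g : I -> Z -> R) (L : Z -> R) :
  uniq s -> (forall i, linear (g i : Z -> R^o)) -> linear (L : Z -> R^o) ->
  (forall h, (forall i, i \in s -> g i h <= 0) -> L h <= 0) ->
  exists2 c : I -> R, (forall i, 0 <= c i) &
    forall h, L h = \sum_(i <- s) c i * g i h.
Proof.
elim: s g L => [|i s IH] g L /=.
  move=> _ _ lL Lle0; exists (fun=> 0) => // h; rewrite big_nil.
  apply/eqP; rewrite eq_le Lle0//= -oppr_le0 -mulN1r -(scalar_linearZ lL).
  exact: Lle0.
move=> /andP[iNs us] lg lL Lle0.
have [/IH|] :=
  pselect (forall h, (forall j, j \in s -> g j h <= 0) -> L h <= 0).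
  case=> // c c0 Lc; exists (fun j => if j == i then 0 else c j).
    by move=> j; case: ifP.
  move=> h; rewrite big_cons eqxx mul0r add0r Lc; apply: eq_big_seq => j js.
  by case: eqP => // ji; move: iNs; rewrite -ji js.
move=> /existsNP[h1 /not_implyP[gh1 /negP]]; rewrite -ltNge => Lh1.
have gih1 : 0 < g i h1.
  rewrite ltNge; apply/negP => gih1; move: Lh1; apply/negP; rewrite -leNgt.
  by apply: Lle0 => j; rewrite inE => /orP[/eqP ->//|/gh1].
pose h0 := (g i h1)^-1 *: h1.
have gih0 : g i h0 = 1 by rewrite (scalar_linearZ (lg i)) mulVf// gt_eqF.
have gh0 j : j \in s -> g j h0 <= 0.
  move=> js; rewrite (scalar_linearZ (lg j)).
  by rewrite mulr_ge0_le0 ?gh1// invr_ge0 ltW.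
have Lh0 : 0 < L h0 by rewrite (scalar_linearZ lL) mulr_gt0// invr_gt0.
clearbody h0; pose p h := h - g i h *: h0.
have pl a x y : p (a *: x + y) = a *: p x + p y.
  rewrite /p (scalar_linearD (lg i)) (scalar_linearZ (lg i)).
  rewrite scalerBr scalerA scalerDl.
  by rewrite opprD addrACA.
have [| | | |c c0 Lc] := IH (fun j h => g j (p h)) (fun h => L (p h)).
- exact: us.
- by move=> j a x y; rewrite pl lg.
- by move=> a x y; rewrite pl lL.
- move=> h gph; apply: Lle0 => j; rewrite inE => /orP[/eqP ->|/gph//].
  by rewrite (scalar_linearB (lg i)) (scalar_linearZ (lg i)) gih0 mulr1 subrr.
(* The coefficient of [g i] is forced by evaluation at [h0], where [g i] is 1. It is nonnegative
   because [L h0] is positive and the other [g k h0] are nonpositive. *)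
exists (fun j => if j == i then L h0 - \sum_(k <- s) c k * g k h0 else c j).
  move=> j; case: ifP => // _; rewrite subr_ge0 (le_trans _ (ltW Lh0))//.
  by rewrite big_seq sumr_le0// => k ks; rewrite mulr_ge0_le0// gh0.
move=> h; rewrite big_cons eqxx.
have -> : \sum_(j <- s)
    (if j == i then L h0 - \sum_(k <- s) c k * g k h0 else c j) * g j h =
    \sum_(j <- s) c j * g j h.
  apply: eq_big_seq => j js.
  by case: eqP => // ji; move: iNs; rewrite -ji js.
have := Lc h; rewrite (scalar_linearB lL) (scalar_linearZ lL) => /eqP.
rewrite subr_eq => /eqP ->.
under eq_bigr do
  rewrite (scalar_linearB (lg _)) (scalar_linearZ (lg _)) mulrBr mulrCA.
rewrite sumrB -mulr_sumr; ring.
Qed.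

(** An equality is a pair of opposite inequalities: [G] doubles each functional by a sign, [Q] keeps
    both signs on [E] and only the positive one on the rest of [A]. The multiplier of [i] is the
    signed sum over its kept copies, hence of free sign on [E] only. *)
Lemma farkas (n : nat) (g : 'I_n -> Z -> R) (L : Z -> R) (E A : {pred 'I_n}) :
  (forall i, linear (g i : Z -> R^o)) -> linear (L : Z -> R^o) ->
  (forall h, (forall i, i \in E -> g i h = 0) ->
     (forall i, i \in A -> g i h <= 0) -> L h <= 0) ->
  exists c : 'I_n -> R,
    [/\ forall i, i \notin E -> 0 <= c i,
        forall i, i \notin E -> i \notin A -> c i = 0 &
        forall h, L h = \sum_(i < n) c i * g i h].
Proof.
move=> lg lL Lle0.
pose G (p : 'I_n * bool) h := (-1) ^+ p.2 * g p.1 h.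
pose Q (p : 'I_n * bool) := (p.1 \in E) || (p.1 \in A) && ~~ p.2.
have lG p : linear (G p : Z -> R^o).
  move=> a x y; rewrite /G (scalar_linearD (lg _)) (scalar_linearZ (lg _)).
  by rewrite mulrDr mulrCA.
have [|c c0 Lc] := @farkas_seq _ (enum Q) G L (enum_uniq _) lG lL.
  move=> h Gh.
  have {}Gh p : Q p -> G p h <= 0 by move=> Qp; apply: Gh; rewrite mem_enum.
  apply: Lle0 => i iP; last first.
    by have := Gh (i, false); rewrite /Q/= iP orbT /G expr0 mul1r; exact.
  apply/eqP; rewrite eq_le; apply/andP; split.
    by have := Gh (i, false); rewrite /Q/= iP /G expr0 mul1r; exact.
  have := Gh (i, true); rewrite /Q/= iP /G expr1 mulN1r oppr_le0; exact.
exists (fun i =>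
  \sum_(b : bool) (if Q (i, b) then (-1) ^+ b * c (i, b) else 0)).
split=> [i iE|i iE iA|h].
- rewrite big_bool /Q/= (negbTE iE) andbF/= add0r andbT.
  by case: ifP => // _; rewrite expr0 mul1r.
- by rewrite big_bool /Q/= (negbTE iE) (negbTE iA) addr0.
rewrite Lc big_enum big_mkcond/=.
rewrite (eq_bigr (fun p => if Q (p.1, p.2) then
  c (p.1, p.2) * G (p.1, p.2) h else 0)); last by case.
rewrite -(pair_bigA _ (fun i b =>
  if Q (i, b) then c (i, b) * G (i, b) h else 0))/=.
apply: eq_bigr => i _; rewrite mulr_suml; apply: eq_bigr => b _.
by case: ifP; rewrite ?mul0r// /G/= mulrCA mulrA.
Qed.

End farkas.

(** * Complete row vectors, small parameters and strict derivatives *)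

HB.instance Definition _ (R : realType) (m n : nat) :=
  Complete.on 'M[R]_(m, n).

Lemma near_right0_mul_lt (R : realType) (K e : R) : 0 <= K -> 0 < e ->
  \forall d \near 0^'+, d * K < e.
Proof.
move=> K0 e0; have K1 : 0 < K + 1 by rewrite ltr_wpDl.
near=> d; apply: (@le_lt_trans _ _ (d * (K + 1))).
  by rewrite ler_wpM2l// lerDl.
rewrite -ltr_pdivlMr//; near: d.
by apply: nbhs_right_lt; rewrite divr_gt0.
Unshelve. all: by end_near. Qed.

Lemma mx_norm_leP (R : realType) (n : nat) (c : 'rV[R]_n) (a : R) : 0 <= a ->
  `|c| <= a <-> (forall i, `|c 0 i| <= a).
Proof.
move=> a0; rewrite [`|c|]mx_normrE; split=> [ca i|ca].
  exact: le_trans (le_bigmax _ (fun p => `|c p.1 p.2|) (0, i)) ca.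
by apply: bigmax_le => // -[i j] _ /=; rewrite (ord1 i).
Qed.

Section strict_derivative.
Context {R : realType} {Z : normedModType R}.

(** Strict differentiability makes [f - D] Lipschitz with constant [e] on a small ball. Stating it
    for all small [d] lets the radii of several functions be chosen together. *)
Lemma strict_derivative_near (f : Z -> R) (zbar : Z) (D : Z -> R) (e : R) :
  is_strict_derivative f zbar D -> 0 < e ->
  \forall d \near 0^'+, forall z h, `|z - zbar| < d -> `|h| < d ->
    `|f (z + h) - f z - D h| <= e * `|h|.
Proof.
move=> [[lD _] /cvgrPdist_le fD] e0.
have [[A B] [/= /nbhs_normP[a /= a0 Aa] /nbhs_normP[b /= b0 Bb]] AB] := fD _ e0.
near=> d => z h zd hd.
have [->|h0] := eqVneq h 0.
  by rewrite addr0 subrr sub0r (scalar_linear0 lD) oppr0 !normr0 mulr0.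
have /= := AB (z, h); rewrite sub0r normrN normrM normfV normr_id.
rewrite ler_pdivrMr ?normr_gt0//; apply; split.
  apply: Aa => /=; rewrite distrC (lt_le_trans zd)//; near: d.
  exact: nbhs_right_le.
apply: Bb => //=; rewrite sub0r normrN (lt_le_trans hd)//; near: d.
exact: nbhs_right_le.
Unshelve. all: by end_near. Qed.

Lemma strict_derivative_continuous (f : Z -> R) (zbar : Z) (D : Z -> R) :
  is_strict_derivative f zbar D -> {for zbar, continuous (f : Z -> R^o)}.
Proof.
move=> fD; have [[lD cD] _] := fD.
apply/cvgrPdist_lt => e e0; near (0 : R)^'+ => d.
have d0 : 0 < d by near: d; exact: nbhs_right_gt.
have fd : forall h, `|h| < d -> `|f (zbar + h) - f zbar - D h| <= 1 * `|h|.
  suff: forall z h, `|z - zbar| < d -> `|h| < d ->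
      `|f (z + h) - f z - D h| <= 1 * `|h|.
    by move=> fd h; apply: fd; rewrite subrr normr0.
  by near: d; exact: strict_derivative_near.
have de : d < e / 2 by near: d; apply: nbhs_right_lt; rewrite divr_gt0.
near=> z.
have zd : `|z - zbar| < d.
  by rewrite distrC; near: z; apply/nbhs_normP; exists d.
have Dz : `|D (z - zbar)| < e / 2.
  rewrite (scalar_linearB lD) distrC; near: z.
  by have /cvgrPdist_lt := cD zbar; apply; rewrite divr_gt0.
have := fd _ zd; rewrite [zbar + _]addrC subrK mul1r => fz.
rewrite distrC -(subrK (D (z - zbar)) (f z - f zbar)).
rewrite (le_lt_trans (ler_normD _ _))// (splitr e) ltrD//.
by rewrite (le_lt_trans fz)// (lt_trans zd).
Unshelve. all: by end_near. Qed.

End strict_derivative.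

(** * Feasible steps from points near the reference point *)

Section feasible_perturbation.
Context {R : realType} {Z : normedModType R} {n : nat}.
Variables (F D : 'I_n -> Z -> R) (zbar : Z) (E : {pred 'I_n}) (b : 'I_n -> Z).
Hypothesis F_strict : forall i, is_strict_derivative (F i) zbar (D i).
Hypothesis D_b : forall i j, i \in E -> j \in E -> D i (b j) = (i == j)%:R.

(** The correction of a step. As [b] is dual to the [D i], each [D i] with [i] in [E] reads off the
    coordinate [c 0 i], so the linearized equalities have the identity as their matrix. *)
Let comb (c : 'rV[R]_n) := \sum_(j in E) c 0 j *: b j.
Let M := \sum_(j in E) `|b j|.

Let lD i : linear (D i : Z -> R^o).
Proof. by have [[]] := F_strict i. Qed.

Let M0 : 0 <= M. Proof. exact: sumr_ge0. Qed.

Let combB c c' : comb c - comb c' = comb (c - c').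
Proof.
by rewrite /comb -sumrB; apply: eq_bigr => i _; rewrite !mxE scalerBl.
Qed.

Let D_comb i c : i \in E -> D i (comb c) = c 0 i.
Proof.
move=> iE; rewrite (scalar_linear_sum (lD i)) (bigD1 i)//= big1 => [|j].
  by rewrite addr0 (scalar_linearZ (lD i)) D_b// eqxx mulr1.
move=> /andP[jE ji]; rewrite (scalar_linearZ (lD i)) D_b//.
by rewrite eq_sym (negbTE ji) mulr0.
Qed.

Let comb_le c : `|comb c| <= `|c| * M.
Proof.
rewrite (le_trans (ler_norm_sum _ _ _))// mulr_sumr ler_sum// => j _.
by rewrite normrZ ler_wpM2r// (mx_norm_leP c _).1.
Qed.

(* Newton-type iteration in the coordinates [c]: it is a contraction because
   [F] deviates from [D] by a small Lipschitz constant near [zbar]. *)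
Lemma equality_correction (h : Z) (e : R) :
  (forall i, i \in E -> D i h = 0) -> 0 < e ->
  \forall d \near 0^'+, forall z t, `|z - zbar| < d -> 0 < t < d ->
    (forall i, i \in E -> F i z = 0) ->
    exists2 c : 'rV[R]_n, `|c| <= e * t &
      forall i, i \in E -> F i (z + (t *: h + \sum_(j in E) c 0 j *: b j)) = 0.
Proof.
move=> Dh e0.
(* [e'] is the Lipschitz constant of the [F i - D i]. The bound with the norm of [h] and the bound
   with [M] each contribute [e * t / 2], so the ball [U] of radius [e * t] is mapped into itself;
   the latter also gives the contraction factor 1/2. *)
near (0 : R)^'+ => e'.
have e'0 : 0 < e' by near: e'; exact: nbhs_right_gt.
have e'h : e' * `|h| < e / 2.
  by near: e'; apply: near_right0_mul_lt => //; rewrite divr_gt0.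
have e'M : e' * M < 2^-1.
  by near: e'; apply: near_right0_mul_lt => //; rewrite invr_gt0.
near (0 : R)^'+ => d0.
have d00 : 0 < d0 by near: d0; exact: nbhs_right_gt.
have Fd0 : forall i z k, `|z - zbar| < d0 -> `|k| < d0 ->
    `|F i (z + k) - F i z - D i k| <= e' * `|k|.
  near: d0; apply: filter_forall => i.
  exact: strict_derivative_near (F_strict i) e'0.
near=> d => z t zd /andP[t0 td] Fz.
have d_gt0 : 0 < d by exact: lt_trans td.
(* This keeps all points and increments below in the ball of radius [d0]: 1 accounts for [z - zbar],
   the norm of [h] for [t *: h], and [2 * e * M] for one correction or the difference of two. *)
have dd0 : d * (1 + `|h| + 2 * e * M) < d0.
  near: d; apply: near_right0_mul_lt => //.
  by rewrite !addr_ge0// !mulr_ge0// ltW.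
have et0 : 0 <= e * t by rewrite mulr_ge0// ltW.
have th : `|t *: h| <= d * `|h|.
  by rewrite normrZ ger0_norm ?(ltW t0)// ler_wpM2r// ltW.
pose U : set 'rV[R]_n := [set c | `|c| <= e * t].
have Uc c : U c -> `|comb c| <= e * t * M.
  by move=> cU; rewrite (le_trans (comb_le c))// ler_wpM2r.
have etd : e * t * M <= d * (e * M).
  by rewrite [d * _]mulrCA -mulrA ler_wpM2l ?(ltW e0)// ler_wpM2r// ltW.
have dhM0 : 0 <= d * `|h| by rewrite mulr_ge0// ltW.
have deM0 : 0 <= d * (e * M) by rewrite !mulr_ge0// ltW.
(* A fixed point of [T] solves the equalities. Coordinates outside [E], which [comb] ignores, are
   set to zero. *)
pose T (c : 'rV[R]_n) : 'rV[R]_n := \row_i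
  (if i \in E then c 0 i - F i (z + (t *: h + comb c)) else 0).
have TU : set_fun U U T.
  move=> c cU; rewrite /U/=; apply/mx_norm_leP => // i; rewrite mxE.
  case: ifPn => iE; last by rewrite normr0.
  have zd0 : `|z - zbar| < d0 by lra.
  have cd0 : `|t *: h + comb c| < d0.
    by rewrite (le_lt_trans (ler_normD _ _))//; have := Uc _ cU; lra.
  have := Fd0 i _ _ zd0 cd0; rewrite (Fz _ iE) subr0.
  rewrite (scalar_linearD (lD i)) (scalar_linearZ (lD i)) Dh// mulr0 add0r.
  rewrite D_comb// distrC => /le_trans; apply.
  rewrite (@le_trans _ _ (e' * (t * `|h| + e * t * M)))//.
    rewrite ler_wpM2l ?(ltW e'0)// (le_trans (ler_normD _ _))// lerD ?Uc//.
    by rewrite normrZ ger0_norm// ltW.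
  have -> : e' * (t * `|h| + e * t * M) = t * (e' * `|h|) + (e * t) * (e' * M).
    by ring.
  rewrite [leRHS](_ : _ = t * (e / 2) + (e * t) * 2^-1); last by field.
  by rewrite lerD// ler_wpM2l// ltW.
have TC : is_contraction (mkfun_fun TU).
  have h20 : (0 : R) <= 2^-1 by rewrite invr_ge0.
  exists (NngNum h20); split=> /=; first by rewrite invf_lt1// ltr1n.
  move=> -[c c'] [/= cU c'U]; apply/mx_norm_leP => [|i]; first exact: mulr_ge0.
  rewrite !mxE; case: ifPn => iE; last by rewrite subrr normr0 mulr_ge0.
  have cd0 : `|z + (t *: h + comb c') - zbar| < d0.
    rewrite addrAC (le_lt_trans (ler_normD _ _))//.
    have := ler_normD (t *: h) (comb c'); have := Uc _ c'U; lra.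
  have ccd0 : `|comb (c - c')| < d0.
    rewrite -combB (le_lt_trans (ler_normB _ _))//.
    by have := Uc _ c'U; have := Uc _ cU; lra.
  have := Fd0 i _ _ cd0 ccd0; rewrite D_comb// -combB.
  have -> : z + (t *: h + comb c') + (comb c - comb c') = z + (t *: h + comb c).
    by rewrite -!addrA [comb c' + _]addrC subrK.
  rewrite !mxE combB => Fcc.
  have -> : c 0 i - F i (z + (t *: h + comb c)) -
      (c' 0 i - F i (z + (t *: h + comb c'))) =
    - (F i (z + (t *: h + comb c)) - F i (z + (t *: h + comb c')) -
      (c 0 i - c' 0 i)) by ring.
  rewrite normrN (le_trans Fcc)//.
  rewrite (@le_trans _ _ (e' * (`|c - c'| * M)))//.
    by rewrite ler_wpM2l ?(ltW e'0)// comb_le.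
  by rewrite mulrCA mulrC ler_wpM2r// ltW.
(* Row vectors are complete, and [U] is a closed ball around 0. *)
have [||c cU cT] := banach_fixed_point TC.
- have -> : U = closed_ball_ Num.norm (0 : 'rV[R]_n) (e * t).
    by apply/seteqP; split=> c; rewrite /U /closed_ball_/= sub0r normrN.
  exact: closed_closed_ball_.
- by exists 0; rewrite /U/= normr0.
exists c => // i iE.
have := congr1 (fun c : 'rV[R]_n => c 0 i) cT; rewrite /= mxE iE => /eqP.
by rewrite -subr_eq0 opprB addrC subrK => /eqP.
Unshelve. all: by end_near. Qed.

End feasible_perturbation.

Section feasible_direction.
Context {R : realType} {Z : normedModType R} {n : nat}.
Variables (F D : 'I_n -> Z -> R) (zbar : Z) (E : {pred 'I_n}) (b : 'I_n -> Z).
Hypothesis F_strict : forall i, is_strict_derivative (F i) zbar (D i).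
Hypothesis D_b : forall i j, i \in E -> j \in E -> D i (b j) = (i == j)%:R.

Definition feasible (z : Z) : Prop :=
  (forall i, i \in E -> F i z = 0) /\ (forall i, i \notin E -> F i z <= 0).

(** The equalities are restored by [equality_correction]. For an active inequality the strict
    decrease [t * D i h] outweighs both the effect of the correction and the linearization error; an
    inactive one stays negative by continuity. *)
Lemma feasible_direction (h : Z) (e : R) :
  feasible zbar -> (forall i, i \in E -> D i h = 0) ->
  (forall i, i \notin E -> F i zbar = 0 -> D i h < 0) -> 0 < e ->
  \forall d \near 0^'+, forall z t, `|z - zbar| < d -> 0 < t < d ->
    feasible z ->
    exists2 c : 'rV[R]_n, `|c| <= e * t &
      feasible (z + (t *: h + \sum_(j in E) c 0 j *: b j)).
Proof.
move=> [_ Fzbar] DhE DhA e0.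
have lD i : linear (D i : Z -> R^o) by have [[]] := F_strict i.
pose M := \sum_(j in E) `|b j|.
pose K i := \sum_(j in E) `|D i (b j)|.
have M0 : 0 <= M by exact: sumr_ge0.
have K0 i : 0 <= K i by exact: sumr_ge0.
(* [e1 <= e] yields the required bound on [c], and [e1 < 1] yields norm at most [t], so that the
   whole step [k] is of order [t]. *)
near (0 : R)^'+ => e1.
have e10 : 0 < e1 by near: e1; exact: nbhs_right_gt.
have e1e : e1 <= e by near: e1; exact: nbhs_right_le.
have e11 : e1 < 1 by near: e1; exact: nbhs_right_lt.
(* [K i] measures the effect of the correction on [D i]; the other summand measures the
   linearization error along the step. *)
have De1 i : i \notin E -> F i zbar = 0 -> e1 * (K i + (`|h| + M)) < - D i h.
  move: i; near: e1; apply: filter_forall => i.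
  have [iE|iE] := boolP (i \in E); first exact: nearW.
  have [Fi0|/eqP Fi0] := eqVneq (F i zbar) 0; last exact: nearW.
  have : \forall d \near 0^'+, d * (K i + (`|h| + M)) < - D i h.
    apply: near_right0_mul_lt; first by rewrite !addr_ge0.
    by rewrite oppr_gt0 DhA.
  by apply: filterS => x Kx _ _.
near (0 : R)^'+ => d0.
have d00 : 0 < d0 by near: d0; exact: nbhs_right_gt.
have Fd0 : forall i z k, `|z - zbar| < d0 -> `|k| < d0 ->
    `|F i (z + k) - F i z - D i k| <= e1 * `|k|.
  near: d0; apply: filter_forall => i.
  exact: strict_derivative_near (F_strict i) e10.
have Finact : forall i z, i \notin E -> F i zbar != 0 -> `|z - zbar| < d0 ->
    F i z <= 0.
  near: d0; apply: filter_forall => i.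
  have [iE|iE] := boolP (i \in E); first exact: nearW.
  have [Fi0|Fi0] := eqVneq (F i zbar) 0; first exact: nearW.
  have Fneg : F i zbar < 0 by rewrite lt_neqAle Fi0 Fzbar.
  have /nbhs_normP[a /= a0 Fa] : \forall z \near zbar, F i z < 0.
    exact: (cvgr_lt _ (strict_derivative_continuous (F_strict i)) _ Fneg).
  have : \forall d \near 0^'+, d <= a by exact: nbhs_right_le.
  apply: filterS => d da z _ _ zd; apply/ltW/Fa.
  by rewrite /= distrC (lt_le_trans zd).
near=> d.
have dd0 : d * (1 + (`|h| + M)) < d0.
  by near: d; apply: near_right0_mul_lt => //; rewrite !addr_ge0.
have correct : forall z t, `|z - zbar| < d -> 0 < t < d ->
    (forall i, i \in E -> F i z = 0) ->
    exists2 c : 'rV[R]_n, `|c| <= e1 * t &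
      forall i, i \in E -> F i (z + (t *: h + \sum_(j in E) c 0 j *: b j)) = 0.
  by near: d; exact: (equality_correction F_strict D_b DhE e10).
move=> z t zd t0d [zE zA]; have [c ce1 cE] := correct z t zd t0d zE.
have /andP[t0 td] := t0d.
have d_gt0 : 0 < d by exact: lt_trans td.
have cte : `|c| <= t by rewrite (le_trans ce1)// ger_pMl// ltW.
exists c; first by rewrite (le_trans ce1)// ler_wpM2r// ltW.
split=> // i iE; set k := t *: h + _.
have c_le j : `|c 0 j| <= `|c| by exact: (mx_norm_leP c _).1.
have k_le : `|k| <= t * (`|h| + M).
  rewrite (le_trans (ler_normD _ _))// normrZ ger0_norm ?(ltW t0)//.
  rewrite mulrDr lerD2l (le_trans (ler_norm_sum _ _ _))// mulr_sumr.
  by apply: ler_sum => j _; rewrite normrZ ler_wpM2r// (le_trans (c_le j)).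
have k_lt : `|k| <= d * (`|h| + M).
  by rewrite (le_trans k_le)// ler_wpM2r ?addr_ge0// ltW.
have hM0 : 0 <= d * (`|h| + M) by rewrite mulr_ge0 ?addr_ge0// ltW.
have [Fi0|Fi0] := eqVneq (F i zbar) 0; last first.
  apply: Finact => //; rewrite addrAC (le_lt_trans (ler_normD _ _))//; lra.
have zd0 : `|z - zbar| < d0 by lra.
have kd0 : `|k| < d0 by lra.
have := Fd0 i _ _ zd0 kd0; rewrite ler_norml => /andP[_ Fk].
have Dk : D i k <= t * D i h + t * (e1 * K i).
  rewrite (scalar_linearD (lD i)) (scalar_linearZ (lD i)) lerD2l.
  rewrite (scalar_linear_sum (lD i)) mulrCA mulrA mulr_sumr.
  apply: ler_sum => j _; rewrite (scalar_linearZ (lD i)).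
  by rewrite (le_trans (ler_norm _))// normrM ler_wpM2r// (le_trans (c_le j)).
have e1k : e1 * `|k| <= t * (e1 * (`|h| + M)).
  by rewrite [leRHS]mulrCA ler_wpM2l// ltW.
have /ltW := De1 i iE Fi0; rewrite -(ler_pM2l t0) => De.
have := zA i iE; lra.
Unshelve. all: by end_near. Qed.

End feasible_direction.

(** * Frechet subgradients and the multiplier rule for limiting subgradients *)

Section frechet.
Context {R : realType} {X : normedModType R}.

(** The bound on the difference quotient is multiplied out. At [y = x] the resulting inequality is
    trivial, so full neighbourhoods replace punctured ones. *)
Lemma frechet_subgradientP (f : X -> R) (x : X) (xs : X -> R) :
  frechet_subgradient f x xs <-> topological_dual xs /\
  forall e, 0 < e -> \forall y \near x,
    f x + xs (y - x) - e * `|y - x| <= f y.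
Proof.
rewrite /frechet_subgradient limf_einfE; split=> -[dxs fxs]; split=> //.
  move=> e e0.
  have : ((- e)%:E < ereal_sup [set ereal_inf
      [set ((f y - f x - xs (y - x)) / `|y - x|)%:E | y in V]
      | V in dnbhs x])%E.
    by rewrite (lt_le_trans _ fxs)// lte_fin oppr_lt0.
  move=> /ereal_sup_gt[_ [V xV <-]] /ltW eV.
  have : \forall y \near x, y != x -> V y by exact: xV.
  apply: filterS => y yV; have [->|yx] := eqVneq y x.
    by rewrite subrr normr0 mulr0 subr0 (scalar_linear0 dxs.1) addr0.
  have : ((- e)%:E <= ((f y - f x - xs (y - x)) / `|y - x|)%:E)%E.
    by apply: (le_trans eV); apply: ereal_inf_lbound; exists y => //; exact: yV.
  rewrite lee_fin ler_pdivlMr ?normr_gt0 ?subr_eq0// mulNr; lra.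
apply/lee_addgt0Pr => e e0; rewrite -leeBlDr// sub0e -EFinN.
pose V := [set y | y != x /\ f x + xs (y - x) - e * `|y - x| <= f y].
apply: (@le_trans _ _ (ereal_inf
   [set ((f y - f x - xs (y - x)) / `|y - x|)%:E | y in V])).
  apply: le_ereal_inf_tmp => _ [y [yx fy] <-]; rewrite lee_fin.
  rewrite ler_pdivlMr ?normr_gt0 ?subr_eq0// mulNr; move: fy; lra.
apply: ereal_sup_ubound; exists V => //; rewrite /dnbhs /within/=.
by have := fxs e e0; apply: filterS => y fy yx; split.
Qed.

End frechet.

(** If no vector in the kernel of the other functionals had [g j] positive, Farkas' lemma with
    equalities only would make [g j] a combination of them, against independence. Such a vector is
    then normalized. *)
Lemma biorthogonal_family (R : realType) (Z : lmodType R) (n : nat)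
    (g : 'I_n -> Z -> R) (E : {pred 'I_n}) :
  (forall i, linear (g i : Z -> R^o)) ->
  (forall c : 'I_n -> R, (forall h, \sum_(i in E) c i * g i h = 0) ->
     forall i, i \in E -> c i = 0) ->
  exists b : 'I_n -> Z,
    forall i j, i \in E -> j \in E -> g i (b j) = (i == j)%:R.
Proof.
move=> lg indep.
suff /choice[b bP] : forall j, exists h,
    j \in E -> forall i, i \in E -> g i h = (i == j)%:R.
  by exists b => i j iE jE; exact: bP.
move=> j; have [jE|_] := boolP (j \in E); last by exists 0.
pose E' : {pred 'I_n} := [pred i in E | i != j].
have [h [hE' hj]] : exists h, (forall i, i \in E' -> g i h = 0) /\ 0 < g j h.
  apply: contrapT => noh.
  have [|c [_ c0 gj]] := @farkas _ _ _ g (g j) E' pred0 lg (lg j).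
    move=> h hE' _; rewrite leNgt; apply/negP => gjh; apply: noh.
    by exists h.
  have cj : c j = 0 by apply: c0; rewrite /E' ?inE ?eqxx ?andbF.
  (* This dependence relation has coefficient -1 at [j], since [c j = 0]. *)
  have dep h : \sum_(i in E) (c i - (i == j)%:R) * g i h = 0.
    under eq_bigr do rewrite mulrBl.
    rewrite sumrB [X in _ - X](_ : _ = g j h); last first.
      rewrite (bigD1 j)//= eqxx mul1r big1 ?addr0// => i /andP[_ /negbTE ->].
      by rewrite mul0r.
    rewrite gj [X in X - _]big_mkcond/= -sumrB big1// => i _; case: ifPn => iE.
      by rewrite subrr.
    by rewrite c0 ?mul0r ?subrr// /E' inE (negbTE iE).
  have /eqP := indep _ dep j jE.
  by rewrite cj eqxx sub0r oppr_eq0 oner_eq0.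
exists ((g j h)^-1 *: h) => _ i iE; rewrite (scalar_linearZ (lg i)).
have [->|ij] := eqVneq i j; first by rewrite mulVf// gt_eqF.
by rewrite (hE' i) ?mulr0// /E' inE iE ij.
Qed.

Section multiplier_rule.
Context {R : realType} {X : normedModType R} {n : nat}.
Variables (F D : 'I_n -> X * X -> R) (Phi DPhi : X * X -> R) (zbar : X * X).
Variables (E : {pred 'I_n}) (v : X -> R).
Hypothesis F_strict : forall i, is_strict_derivative (F i) zbar (D i).
Hypothesis Phi_strict : is_strict_derivative Phi zbar DPhi.
Hypothesis v_le : forall z, feasible F E z -> v z.1 <= Phi z.

Variables (z_ : nat -> X * X) (xs_ : nat -> X -> R) (xs : X -> R).
Hypothesis zbar_feasible : feasible F E zbar.
Hypothesis z_feasible : forall k, feasible F E (z_ k).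
Hypothesis v_z : forall k, v (z_ k).1 = Phi (z_ k).
Hypothesis z_cvg : z_ @ \oo --> zbar.
Hypothesis xs_cvg : forall h : X,
  (fun k => xs_ k h : R^o) @ \oo --> (xs h : R^o).
Hypothesis xs_subgradient : forall k, frechet_subgradient v (z_ k).1 (xs_ k).
Hypothesis xs_dual : topological_dual xs.

Let L (z : X * X) : R := xs z.1 - DPhi z.

Let linear_sub (ys : X -> R) : linear (ys : X -> R^o) ->
  linear ((fun z => ys z.1 - DPhi z) : X * X -> R^o).
Proof.
move=> lys a x y /=; have [[lDPhi _] _] := Phi_strict.
rewrite (scalar_linearD lDPhi) (scalar_linearZ lDPhi).
by rewrite (scalar_linearD lys) (scalar_linearZ lys) scalerBr opprD addrACA.
Qed.

(* Move from [z_ k] along [h] by a small step [t], correct by [o(t)] to stay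
   feasible, and compare the subgradient inequality for [v] at [(z_ k).1] with
   the first-order expansion of [Phi]. *)
Lemma critical_direction_le (b : 'I_n -> X * X) (h : X * X) :
  (forall i j, i \in E -> j \in E -> D i (b j) = (i == j)%:R) ->
  (forall i, i \in E -> D i h = 0) ->
  (forall i, i \notin E -> F i zbar = 0 -> D i h < 0) ->
  L h <= 0.
Proof.
move=> Db hE hA; rewrite leNgt; apply/negP => Lh.
pose M := \sum_(j in E) `|b j|.
pose K := \sum_(j in E) (`|L (b j)| + 1).
have M0 : 0 <= M by exact: sumr_ge0.
have K0 : 0 <= K by apply: sumr_ge0 => j _; rewrite addr_ge0.
near (0 : R)^'+ => e.
have e0 : 0 < e by near: e; exact: nbhs_right_gt.
have e1 : e < 1 by near: e; exact: nbhs_right_lt.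
(* The errors to be beaten: 1 for replacing [L h] by its approximation [Lk k h], [K] for the
   correction along the [b j], and 2 for the subgradient inequality together with the expansion of
   [Phi]. *)
have eL : e * (1 + K + 2 * (`|h| + M)) < L h.
  by near: e; apply: near_right0_mul_lt => //; rewrite !(addr_ge0, mulr_ge0).
near (0 : R)^'+ => d0.
have Phid0 : forall z k, `|z - zbar| < d0 -> `|k| < d0 ->
    `|Phi (z + k) - Phi z - DPhi k| <= e * `|k|.
  by near: d0; exact: strict_derivative_near.
have d00 : 0 < d0 by near: d0; exact: nbhs_right_gt.
near (0 : R)^'+ => d.
have d_gt0 : 0 < d by near: d; exact: nbhs_right_gt.
have dd0 : d < d0 by near: d; exact: nbhs_right_lt.
have feas : forall z t, `|z - zbar| < d -> 0 < t < d -> feasible F E z ->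
    exists2 c : 'rV[R]_n, `|c| <= e * t &
      feasible F E (z + (t *: h + \sum_(j in E) c 0 j *: b j)).
  near: d.
  exact: (feasible_direction F_strict Db zbar_feasible hE hA e0).
pose Lk k (z : X * X) : R := xs_ k z.1 - DPhi z.
have Lk_cvg z : (fun k => Lk k z : R^o) @ \oo --> (L z : R^o).
  by apply: cvgB; [exact: xs_cvg|exact: cvg_cst].
(* Pointwise convergence of [xs_] is enough: it is used only at [h] and the finitely many [b j]. *)
near \oo => k.
have zkd : `|z_ k - zbar| < d.
  by rewrite distrC; near: k; exact: cvgr_dist_lt.
have Lkh : L h - e <= Lk k h.
  suff : `|L h - Lk k h| <= e by rewrite ler_norml; lra.
  by near: k; exact: cvgr_dist_le.
have Lkb : forall j, `|Lk k (b j)| <= `|L (b j)| + 1.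
  move=> j; suff : `|L (b j) - Lk k (b j)| <= 1.
    by have := ler_normB (L (b j)) (L (b j) - Lk k (b j)); rewrite subKr; lra.
  move: j; near: k; apply: filter_forall => j.
  by apply: cvgr_dist_le => //; exact: Lk_cvg.
have [[lxk _] /(_ e e0)/nbhs_normP[a /= a0 va]] :=
  (frechet_subgradientP _ _ _).1 (xs_subgradient k).
(* [t] comes last because the radius [a] depends on [k]. The radii [d] and [d0] do not, by strict
   differentiability at [zbar]. *)
near (0 : R)^'+ => t.
have t0 : 0 < t by near: t; exact: nbhs_right_gt.
have td : t < d by near: t; exact: nbhs_right_lt.
have tMa : t * (`|h| + M) < a.
  by near: t; apply: near_right0_mul_lt => //; rewrite addr_ge0.
have tMd : t * (`|h| + M) < d0.
  by near: t; apply: near_right0_mul_lt => //; rewrite addr_ge0.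
have [|c ce] := feas (z_ k) t zkd _ (z_feasible k); first by rewrite t0.
set w := t *: h + _ => wfeas.
have c_le j : `|c 0 j| <= `|c| by exact: (mx_norm_leP c _).1.
have ct : `|c| <= t by rewrite (le_trans ce)// ger_pMl// ltW.
have w_le : `|w| <= t * (`|h| + M).
  rewrite (le_trans (ler_normD _ _))// normrZ ger0_norm ?(ltW t0)//.
  rewrite mulrDr lerD2l (le_trans (ler_norm_sum _ _ _))// mulr_sumr.
  by apply: ler_sum => j _; rewrite normrZ ler_wpM2r// (le_trans (c_le j)).
have w1_le : `|w.1| <= `|w| by rewrite [leRHS]prod_normE le_max lexx.
have v1 : v (z_ k).1 + xs_ k w.1 - e * `|w.1| <= v ((z_ k).1 + w.1).
  have zw : (z_ k).1 + w.1 - (z_ k).1 = w.1 by rewrite addrC addKr.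
  have /= := va ((z_ k).1 + w.1); rewrite zw; apply.
  rewrite opprD addrA subrr sub0r normrN.
  by rewrite (le_lt_trans w1_le)// (le_lt_trans w_le).
have v2 : v ((z_ k).1 + w.1) <= Phi (z_ k + w) by exact: (v_le wfeas).
have Phiw : Phi (z_ k + w) <= Phi (z_ k) + DPhi w + e * `|w|.
  suff : `|Phi (z_ k + w) - Phi (z_ k) - DPhi w| <= e * `|w|.
    by rewrite ler_norml; lra.
  by apply: Phid0; [exact: lt_trans dd0|exact: le_lt_trans tMd].
have Lkw_le : Lk k w <= 2 * (e * `|w|).
  have : e * `|w.1| <= e * `|w| by rewrite ler_wpM2l// ltW.
  by move: v1 v2 Phiw; rewrite v_z /Lk; lra.
have lLk := linear_sub lxk.
have Lkw : t * (L h - e) - t * (e * K) <= Lk k w.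
  rewrite [Lk k w](scalar_linearD lLk) (scalar_linearZ lLk) lerD//.
    by rewrite ler_wpM2l// ltW.
  rewrite (scalar_linear_sum lLk) lerNl -sumrN [leRHS]mulrA [t * e]mulrC.
  rewrite mulr_sumr; apply: ler_sum => j _; rewrite (scalar_linearZ lLk).
  rewrite (le_trans (ler_norm _))// normrN normrM ler_pM//.
    exact: le_trans ce.
  exact: Lkb.
have ew : e * `|w| <= t * (e * (`|h| + M)).
  by rewrite [leRHS]mulrCA ler_wpM2l// ltW.
have teL : t * (e * (1 + K + 2 * (`|h| + M))) < t * L h by rewrite ltr_pM2l.
by move: (L h) (Lk k w) ew teL Lkw Lkw_le => l lw; lra.
Unshelve. all: by end_near. Qed.

(** For [h] in the linearized cone, [h + s *: xi] strictly decreases the active inequalities, so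
    [critical_direction_le] applies to it. Small [s] gives [L h <= 0], and Farkas' lemma turns this
    into multipliers. *)
Lemma limiting_multiplier_rule (xi : X * X) :
  (forall c : 'I_n -> R, (forall h, \sum_(i in E) c i * D i h = 0) ->
     forall i, i \in E -> c i = 0) ->
  (forall i, i \in E -> D i xi = 0) ->
  (forall i, i \notin E -> F i zbar = 0 -> D i xi < 0) ->
  exists c : 'I_n -> R,
    [/\ forall i, i \notin E -> 0 <= c i,
        forall i, i \notin E -> c i * F i zbar = 0 &
        forall h : X * X, xs h.1 = DPhi h + \sum_(i < n) c i * D i h].
Proof.
move=> indep xiE xiA.
have lD i : linear (D i : X * X -> R^o) by have [[]] := F_strict i.
have [b Db] := biorthogonal_family lD indep.
have lL : linear (L : X * X -> R^o) by exact: linear_sub xs_dual.1.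
pose A : {pred 'I_n} := [pred i | F i zbar == 0].
have [h hE hA|c [c0 cA Lc]] := farkas (E := E) (A := A) lD lL.
  rewrite leNgt; apply/negP => Lh.
  near (0 : R)^'+ => s.
  have s0 : 0 < s by near: s; exact: nbhs_right_gt.
  have sL : s * `|L xi| < L h by near: s; exact: near_right0_mul_lt.
  have : L (h + s *: xi) <= 0.
    apply: (critical_direction_le Db) => [i iE|i iE Fi];
      rewrite (scalar_linearD (lD i)) (scalar_linearZ (lD i)).
      by rewrite hE// xiE// mulr0 addr0.
    rewrite ltr_wnDl ?pmulr_rlt0 ?xiA//.
    by rewrite hA// /A inE Fi.
  rewrite [leLHS](scalar_linearD lL) (scalar_linearZ lL).
  by have := ler_norm (- L xi); rewrite normrN -(ler_pM2l s0); lra.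
exists c; split=> // [i iE|h].
  have [->|Fi] := eqVneq (F i zbar) 0; first by rewrite mulr0.
  by rewrite cA ?mul0r// /A inE (negbTE Fi).
by rewrite -Lc /L addrC subrK.
Unshelve. all: by end_near. Qed.

End multiplier_rule.

(** * Comparison of strict gradients, and subgradients obtained from a selector *)

Lemma strict_gradientP (R : realType) (Z : normedModType R) (f : Z -> R)
    (zbar : Z) :
  strictly_differentiable f zbar ->
  is_strict_derivative f zbar (strict_gradient f zbar).
Proof. exact: getPex. Qed.

(** Equal increments along the single line spanned by [h] suffice. This serves to compare the
    objective with the cost when only [x] moves. *)
Lemma eq_strict_derivative_along (R : realType) (Z : normedModType R)
    (f g : Z -> R) (zbar : Z) (Df Dg : Z -> R) (h : Z) :
  is_strict_derivative f zbar Df -> is_strict_derivative g zbar Dg ->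
  (forall t, f (zbar + t *: h) - f zbar = g (zbar + t *: h) - g zbar) ->
  Df h = Dg h.
Proof.
move=> fD gD fg; apply/eqP; rewrite -subr_eq0 -normr_le0.
rewrite leNgt; apply/negP => Dfg.
near (0 : R)^'+ => e.
have e0 : 0 < e by near: e; exact: nbhs_right_gt.
have eD : e * (2 * `|h|) < `|Df h - Dg h|.
  by near: e; apply: near_right0_mul_lt => //; rewrite mulr_ge0.
near (0 : R)^'+ => d.
have d0 : 0 < d by near: d; exact: nbhs_right_gt.
have fd : forall z k, `|z - zbar| < d -> `|k| < d ->
    `|f (z + k) - f z - Df k| <= e * `|k|.
  by near: d; exact: strict_derivative_near.
have gd : forall z k, `|z - zbar| < d -> `|k| < d ->
    `|g (z + k) - g z - Dg k| <= e * `|k|.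
  by near: d; exact: strict_derivative_near.
near (0 : R)^'+ => t.
have t0 : 0 < t by near: t; exact: nbhs_right_gt.
have thd : `|t *: h| < d.
  by rewrite normrZ gtr0_norm//; near: t; exact: near_right0_mul_lt.
have zz : `|zbar - zbar| < d by rewrite subrr normr0.
have := fd _ _ zz thd; have := gd _ _ zz thd; rewrite fg.
have [[lDf _] _] := fD; have [[lDg _] _] := gD.
rewrite (scalar_linearZ lDf) (scalar_linearZ lDg) normrZ gtr0_norm// => gt ft.
move: eD; rewrite -(ltr_pM2l t0) -[X in X * `|_ - _|](gtr0_norm t0) -normrM.
have -> : t * (Df h - Dg h) = g (zbar + t *: h) - g zbar - t * Dg h -
  (g (zbar + t *: h) - g zbar - t * Df h) by ring.
by have := le_trans (ler_normB _ _) (lerD gt ft); lra.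
Unshelve. all: by end_near. Qed.

Section selector.
Context {R : realType} {X : normedModType R} {n : nat}.
Variables (F D : 'I_n -> X * X -> R) (Phi DPhi : X * X -> R).
Variables (E : {pred 'I_n}) (v : X -> R) (xbar : X) (f : X -> X).
Variable c : 'I_n -> R.
Hypothesis F_strict : forall i, is_strict_derivative (F i) (xbar, f xbar) (D i).
Hypothesis Phi_strict : is_strict_derivative Phi (xbar, f xbar) DPhi.
Hypothesis c_ge0 : forall i, i \notin E -> 0 <= c i.
Hypothesis c_slack : forall i, i \notin E -> c i * F i (xbar, f xbar) = 0.
Hypothesis stationary : forall h,
  DPhi (0, h) + \sum_(i < n) c i * D i (0, h) = 0.
Hypothesis f_lip : locally_upper_lipschitzian [set: X] f xbar.
Hypothesis f_feasible : \forall x \near xbar, feasible F E (x, f x).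
Hypothesis v_f : \forall x \near xbar, v x = Phi (x, f x).

Lemma topological_dual_fst (L : X * X -> R) :
  topological_dual L -> topological_dual (fun h => L (h, 0)).
Proof.
move=> [lL cL]; split=> [a x y|x].
  have -> : (a *: x + y, 0) = a *: (x, 0) + (y, 0) :> X * X.
    by congr (_, _); rewrite /= scaler0 addr0.
  by rewrite lL.
apply: (@cvg_comp _ _ _ (fun h => (h, 0) : X * X) L); last exact: cL.
by apply: cvg_pair => //; exact: cvg_cst.
Qed.

Lemma topological_dual_lagrangian :
  topological_dual (fun h => DPhi (h, 0) + \sum_(i < n) c i * D i (h, 0)).
Proof.
have [lP cP] := topological_dual_fst Phi_strict.1.
have lD i := (topological_dual_fst (F_strict i).1).1.
have cD i := (topological_dual_fst (F_strict i).1).2.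
split=> [a x y|x].
  rewrite (scalar_linearD lP) (scalar_linearZ lP).
  rewrite scalerDr addrACA; congr (_ + _).
  rewrite [X in _ = X + _](mulr_sumr _ _ _ _) -big_split/=.
  apply: eq_bigr => i _; rewrite (scalar_linearD (lD i)).
  by rewrite (scalar_linearZ (lD i)) mulrDr mulrCA.
apply: cvgD; first exact: cP.
apply: cvg_big => [|i _]; first exact: add_continuous.
by apply: cvgM; [exact: cvg_cst|exact: cD].
Qed.

(* A selector turns the feasible first-order expansion of the Lagrangian at
   [(xbar, f xbar)] into a subgradient inequality for [v]; stationarity in [y]
   removes the unknown increment [f x - f xbar]. *)
Lemma selector_frechet_subgradient :
  frechet_subgradient v xbar
    (fun h => DPhi (h, 0) + \sum_(i < n) c i * D i (h, 0)).
Proof.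
apply/frechet_subgradientP; split; first exact: topological_dual_lagrangian.
move=> e e0; have [eta [l [eta0 l0 fl]]] := f_lip.
pose C := \sum_(i < n) `|c i|.
have C0 : 0 <= C by exact: sumr_ge0.
near (0 : R)^'+ => e'.
have e'0 : 0 < e' by near: e'; exact: nbhs_right_gt.
(* [1 + C] collects the errors of [Phi] and of the constraints weighted by their multipliers;
   [1 + l] bounds the increment [k] by that of [x]. *)
have e'e : e' * ((1 + C) * (1 + l)) < e.
  by near: e'; apply: near_right0_mul_lt => //; rewrite mulr_ge0// addr_ge0.
near (0 : R)^'+ => d.
have d0 : 0 < d by near: d; exact: nbhs_right_gt.
have Phid : forall z k, `|z - (xbar, f xbar)| < d -> `|k| < d ->
    `|Phi (z + k) - Phi z - DPhi k| <= e' * `|k|.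
  by near: d; exact: strict_derivative_near.
have Fd : forall i z k, `|z - (xbar, f xbar)| < d -> `|k| < d ->
    `|F i (z + k) - F i z - D i k| <= e' * `|k|.
  near: d; apply: filter_forall => i.
  exact: strict_derivative_near (F_strict i) e'0.
near=> x.
have [FE FA] : feasible F E (x, f x) by near: x.
have -> : v x = Phi (x, f x) by near: x.
have -> : v xbar = Phi (xbar, f xbar) by apply: (nbhs_singleton v_f).
have [FbE _] := nbhs_singleton f_feasible.
have xeta : `|x - xbar| <= eta.
  by rewrite distrC; near: x; apply: cvgr_dist_le => //; exact: cvg_id.
have xd : `|x - xbar| * (1 + l) < d.
  rewrite -ltr_pdivlMr ?ltr_wpDr// distrC; near: x; apply: cvgr_dist_lt.
    exact: cvg_id.
  by rewrite divr_gt0// ltr_wpDr.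
pose k : X * X := (x - xbar, f x - f xbar).
have k_le : `|k| <= `|x - xbar| * (1 + l).
  have fx := fl x I xeta; have := normr_ge0 (x - xbar).
  have : 0 <= `|x - xbar| * l by rewrite mulr_ge0.
  rewrite prod_normE /= ge_max => ? ?; apply/andP; split; lra.
have zk : (xbar, f xbar) + k = (x, f x).
  by congr (_, _); rewrite /= addrC subrK.
have kd : `|k| < d by exact: le_lt_trans xd.
have zz : `|(xbar, f xbar) - (xbar, f xbar)| < d by rewrite subrr normr0.
have := Phid _ _ zz kd; rewrite zk ler_norml => /andP[Phik _].
(* Feasibility makes each [c i * F i] nonpositive at [(x, f x)], while slackness makes it zero at
   [(xbar, f xbar)]; only the linearization error remains. *)
have cDk : \sum_(i < n) c i * D i k <= C * (e' * `|k|).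
  rewrite mulr_suml; apply: ler_sum => i _.
  have := Fd i _ _ zz kd; rewrite zk => Fik.
  have cF : c i * F i (x, f x) <= 0.
    have [iE|iE] := boolP (i \in E); first by rewrite FE// mulr0.
    by rewrite mulr_ge0_le0 ?c_ge0 ?FA.
  have cF0 : c i * F i (xbar, f xbar) = 0.
    by have [iE|iE] := boolP (i \in E); [rewrite FbE// mulr0|exact: c_slack].
  have : c i * D i k <= c i * D i k - c i * F i (x, f x) +
    c i * F i (xbar, f xbar) by rewrite cF0; lra.
  move=> /le_trans; apply.
  have -> : c i * D i k - c i * F i (x, f x) + c i * F i (xbar, f xbar) =
    - (c i * (F i (x, f x) - F i (xbar, f xbar) - D i k)) by ring.
  by rewrite (le_trans (ler_norm _))// normrN normrM ler_wpM2l.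
have split_k (L : X * X -> R) : linear (L : X * X -> R^o) ->
    L k = L (x - xbar, 0) + L (0, f x - f xbar).
  move=> lL; rewrite -(scalar_linearD lL); congr L.
  by congr (_, _); rewrite /= ?addr0 ?add0r.
have -> : DPhi (x - xbar, 0) + \sum_(i < n) c i * D i (x - xbar, 0) =
    DPhi k + \sum_(i < n) c i * D i k.
  rewrite (split_k DPhi Phi_strict.1.1).
  under [in RHS]eq_bigr => i _ do
    rewrite (split_k (D i) (F_strict i).1.1) mulrDr.
  by rewrite big_split/= addrACA stationary addr0.
have eC : e' * `|k| * (1 + C) <= e * `|x - xbar|.
  rewrite (@le_trans _ _ (e' * (`|x - xbar| * (1 + l)) * (1 + C)))//.
    by rewrite ler_wpM2r ?addr_ge0// ler_wpM2l// ltW.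
  rewrite (_ : _ * _ * _ = e' * ((1 + C) * (1 + l)) * `|x - xbar|);
    last by ring.
  by rewrite ler_wpM2r// ltW.
by move: Phik cDk eC; lra.
Unshelve. all: by end_near. Qed.

End selector.

(** * Subgradients of the value function of the dynamic program *)

Theorem theorem5p7 (R : realType) (X : completeNormedModType R)
    (d : measure_display) (Omega : measurableType d)
    (P : R.-pker Omega ~> Omega) (beta : R)
    (u : X -> X -> Omega -> R) (m r : nat)
    (phi : 'I_(m + r) -> X -> X -> Omega -> R)
    (v : X -> Omega -> R) (xbar ybar : X) :
  let Gamma := constraint_set phi in
  let G := policy P beta u Gamma v in
  let objective w (x y : X) := bellman_objective P beta u v x y w in
  0 <= beta < 1 ->
  separable X ->
  asplund X ->
  norm_setting P beta u Gamma v \/ weak_setting P beta u Gamma v ->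
  (forall i x y, measurable_fun setT (phi i x y)) ->
  (forall w, G xbar w ybar) ->
  (forall w,
     strictly_differentiable (fun z : X * X => u z.1 z.2 w) (xbar, ybar)) ->
  (forall w i,
     strictly_differentiable (fun z : X * X => phi i z.1 z.2 w) (xbar, ybar)) ->
  (forall w,
     strictly_differentiable (fun z : X * X => objective w z.1 z.2)
       (xbar, ybar)) ->
  (forall w, strictly_differentiable (v^~ w) ybar) ->
  (forall w, inner_semicontinuous (G^~ w) xbar ybar) ->
  parametric_MFCQ phi xbar ybar ->
  let multiplier_bound w :=
    \bigcup_(lambda in multipliers P beta u v phi xbar ybar w)
      [set lagrange_gradient u phi xbar ybar w lambda] in
  (forall w,
     limiting_subdifferential (v^~ w) xbar `<=` multiplier_bound w) /\
  (forall w,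
     (exists f : X -> X,
        upper_lipschitzian_selector [set: X] (G^~ w) xbar ybar f) ->
     limiting_subdifferential (v^~ w) xbar = multiplier_bound w).
Proof.
move=> Gamma G objective _ _ _ setting _ Gbar u_diff phi_diff obj_diff _ Gisc.
move=> mfcq multiplier_bound.
(* The norm and weak settings are treated together through the Bellman equation, which both
   contain. *)
have value : value_function P beta u Gamma v by case: setting => -[].
pose zbar := (xbar, ybar).
pose E : {pred 'I_(m + r)} := [pred i : 'I_(m + r) | (m <= i)%N].
pose F w (i : 'I_(m + r)) (z : X * X) := phi i z.1 z.2 w.
pose Phi w (z : X * X) := objective w z.1 z.2.
pose D w i := strict_gradient (F w i) zbar.
pose DPhi w := strict_gradient (Phi w) zbar.
have F_strict w i : is_strict_derivative (F w i) zbar (D w i).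
  exact/strict_gradientP/phi_diff.
have Phi_strict w : is_strict_derivative (Phi w) zbar (DPhi w).
  exact/strict_gradientP/obj_diff.
have feasibleP w z : feasible (F w) E z <-> Gamma z.1 w z.2.
  split=> -[].
    move=> zE zA; split=> i im; last by apply: zE; rewrite inE.
    by apply: zA; rewrite inE -ltnNge.
  move=> zA zE; split=> i; rewrite inE; first exact: zE.
  by rewrite -ltnNge; exact: zA.
(* Along [(h, 0)] the second argument stays at [ybar], so the integral term of the objective cancels
   in increments. *)
have DPhi_u w h : DPhi w (h, 0) =
    strict_gradient_x (fun x y => u x y w) xbar ybar h.
  apply: (eq_strict_derivative_along (Phi_strict w)).
    exact/strict_gradientP/u_diff.
  move=> t; rewrite /Phi /objective /bellman_objective /= scaler0 addr0; ring.
have lagrangeE w lambda : lagrange_gradient u phi xbar ybar w lambda =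
    fun h => DPhi w (h, 0) + \sum_(i < m + r) lambda 0 i * D w i (h, 0).
  by apply/funext => h; rewrite DPhi_u.
have upper w : limiting_subdifferential (v^~ w) xbar `<=` multiplier_bound w.
  move=> xs [xs_dual [x_ [xs_ [x_cvg xs_cvg xs_sub]]]].
  have [y_ Gy [s s_mono y_cvg]] := Gisc w x_ x_cvg.
  (* A strictly increasing [s] dominates the identity, so [x_] and [xs_] keep their limits along the
     subsequence on which [y_] converges. *)
  have s_ge k : (k <= s k)%N.
    by elim: k => // k IH; exact: leq_ltn_trans (s_mono k k.+1 _).
  have s_cvg : s @ \oo --> \oo.
    apply/cvgnyPge => N; near=> k; apply: leq_trans (s_ge k).
    by near: k; exact: nbhs_infty_ge.
  have [indep [xi [xiE xiA]]] := mfcq w.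
  pose z_ k : X * X := (x_ (s k), y_ (s k)).
  have v_le z : feasible (F w) E z -> v z.1 w <= Phi w z.
    by move=> /feasibleP; exact: (value_bellman value _ _).2.
  have Fbar : feasible (F w) E zbar by apply/feasibleP; exact: (Gbar w).1.
  have Fz k : feasible (F w) E (z_ k).
    by apply/feasibleP; exact: (Gy (s k)).1.
  have vz k : v (z_ k).1 w = Phi w (z_ k) by exact: (Gy (s k)).2.
  have z_cvg : z_ @ \oo --> zbar.
    by apply: cvg_pair => //; exact: (cvg_comp _ _ s_cvg x_cvg).
  have xis h : (fun k => xs_ (s k) h : R^o) @ \oo --> (xs h : R^o).
    exact: (cvg_comp _ _ s_cvg (xs_cvg h)).
  have xiA' i : i \notin E -> F w i zbar = 0 -> D w i xi < 0.
    by rewrite inE -ltnNge; exact: xiA.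
  have [c [c0 cF cD]] := limiting_multiplier_rule (F_strict w) (Phi_strict w)
    v_le Fbar Fz vz z_cvg xis (fun k => xs_sub (s k)) xs_dual indep xiE xiA'.
  (* Evaluating [cD] at [(0, h)], where [xs] contributes 0, gives stationarity in [y]; evaluating it
     at [(h, 0)] gives the formula for [xs]. *)
  exists (\row_i c i).
    split=> [h|i im].
      have := cD (0, h); rewrite /= (scalar_linear0 xs_dual.1) => cDh.
      by rewrite [RHS]cDh; congr (_ + _); apply: eq_bigr => i _; rewrite mxE.
    have iE : i \notin E by rewrite inE -ltnNge.
    by rewrite mxE; split; [exact: c0|exact: cF].
  rewrite /= lagrangeE; apply/funext => h; rewrite (cD (h, 0)).
  by congr (_ + _); apply: eq_bigr => i _; rewrite mxE.
split=> // w [f [_ f_lip fy f_sel]]; apply/seteqP; split; first exact: upper.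
move=> _ [lambda [stat slack] ->]; rewrite lagrangeE.
have zE : zbar = (xbar, f xbar) by rewrite fy.
have lambda_slack i : i \notin E ->
    0 <= lambda 0 i /\ lambda 0 i * F w i (xbar, f xbar) = 0.
  by rewrite inE -ltnNge -zE => im; exact: slack.
have sel : frechet_subgradient (v^~ w) xbar
    (fun h => DPhi w (h, 0) + \sum_(i < m + r) lambda 0 i * D w i (h, 0)).
  apply: (@selector_frechet_subgradient _ _ _ (F w) _ (Phi w) _ E _ _ f).
  - by move=> i; rewrite -zE; exact: F_strict.
  - by rewrite -zE; exact: Phi_strict.
  - by move=> i iE; exact: (lambda_slack i iE).1.
  - by move=> i iE; exact: (lambda_slack i iE).2.
  - exact: stat.
  - exact: f_lip.
  - by apply: filterS f_sel => x /(_ I)[Gx _]; apply/feasibleP.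
  - by apply: filterS f_sel => x /(_ I)[].
split; first exact: sel.1.
(* Constant sequences show that a Frechet subgradient is a limiting one. *)
exists (fun=> xbar), (fun=> (fun h =>
  DPhi w (h, 0) + \sum_(i < m + r) lambda 0 i * D w i (h, 0))).
by split=> //; [exact: cvg_cst|move=> h; exact: cvg_cst].
Unshelve. all: by end_near. Qed.
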